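(* Let $q\in\mathbb{N}$, fix an inverse temperature $\beta>0$, put $\beta'=\mathrm{e}^\beta-1$, and let the external magnetic fields satisfy $\boldsymbol{B}=(B,0,\dots,0)\in\mathbb{R}^q$ for some $B\ge0$. Consider the optimization problem $$\varphi(\beta,B)=\sup_{\boldsymbol{y}\in\mathbb{R}^q}\Big[F_{\beta,\boldsymbol{B}}(\boldsymbol{y})-\frac{\beta'}{2\mathbb{E}[W]}\sum_{k=1}^q y_k^2\Big].\qquad(\ast)$$ For $s\in[0,1]$ let $\boldsymbol{y}(s)=(y_k(s))_{k\in[q]}$ be given by $y_1(s)=\frac{\mathbb{E}[W]}{q}(1+(q-1)s)$ and $y_k(s)=\frac{\mathbb{E}[W]}{q}(1-s)$ for $k\neq1$. (a) If $B=0$, then any optimizer of $(\ast)$ is a permutation of the vector $\boldsymbol{y}(s)$ for a suitable function $s=s(\beta,0)\in[0,1]$. (b) If $B>0$, then the optimizer of $(\ast)$ is given by $\boldsymbol{y}(s)$ for a suitable function $s=s(\beta,B)\in[0,1]$. Consequently, $$\varphi(\beta,B)=\sup_{s\in[0,1]}p_{\beta,B}(s),\qquad p_{\beta,B}(s)=\mathbb{E}\big[\log(\mathrm{e}^{\beta'Ws+B}+q-1)\big]-\frac{\beta'\mathbb{E}[W]}{2q}\big[(q-1)s^2+2s-1\big].$$ Any optimal solution $s=s(\beta,B)$ of this last variational problem satisfies the stationarity condition $$\mathbb{E}\Big[\frac{W}{\mathbb{E}[W]}\,\frac{\mathrm{e}^{\beta'Ws+B}-1}{\mathrm{e}^{\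beta'Ws+B}+q-1}\Big]=s.$$
   Context: The rank-1 inhomogeneous (generalized) random graph on vertex set $[n]=\{1,\dots,n\}$ with positive weights $(w_i)_{i\in[n]}$ has independent edges, the edge $\{i,j\}$ being present with probability $\frac{w_iw_j}{\ell_n+w_iw_j}$, where $\ell_n=\sum_{i\in[n]}w_i$. Let $F_n(x)=\frac1n\sum_{i\in[n]}\mathbf{1}\{w_i\le x\}$ and let $W_n$ have distribution function $F_n$. It is assumed that $W_n$ converges in distribution to a random variable $W$ with $\mathbb{E}[W]>0$, and that there exist $c>0$ and $\tau>2$ with $1-F_n(w)\le c\,w^{-(\tau-1)}$ for all $w\ge1$ (in particular $\mathbb{E}[W]<\infty$). Expectations in the claim are with respect to $W$. For $\boldsymbol{B}=(B_1,\dots,B_q)$ and $\boldsymbol{y}=(y_1,\dots,y_q)\in\mathbb{R}^q$, $$F_{\beta,\boldsymbol{B}}(\boldsymbol{y})=\mathbb{E}\Big[\log\Big(\sum_{k=1}^q\mathrm{e}^{\frac{\beta'}{\mathbb{E}[W]}y_kW+B_k}\Big)\Big].$$ The value $\varphi(\beta,B)$ of $(\ast)$ is the limit as $n\to\infty$ of the annealed pressure per particle $\frac1n\log\mathbb{E}[Z_n(\beta,\boldsymbol{B})]$ of the $q$-state Potts model on this graph, where $Z_n(\beta,\boldsymbol{B})=\sum_{\boldsymbol{\sigma}\in[q]^n}\exp\big[\beta\sum_{i<j}I_{i,j}\mathbf{1}\{\sigma_i=\sigma_j\}+\sum_{i\in[n]}\sum_{k\in[q]}B_k\mathbf{1}\{\sigma_i=k\}\big]$,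 $I_{i,j}$ is the indicator that the edge $\{i,j\}$ is present, $[q]=\{1,\dots,q\}$, and the expectation of $Z_n$ is over the random graph. An optimizer (optimal solution) is a point where the supremum is attained.
   Formalization: The stationarity condition is stated only for q ≥ 2: for q = 1 the function p is constant, so s = 1 is optimal, yet the left side of the stationarity condition is then strictly less than 1; all other claims are stated for every q ≥ 1. *)

(* Defs.v *)
From HB Require Import structures.
From mathcomp Require Import all_boot all_order all_algebra.
From mathcomp Require Import all_fingroup.
From mathcomp Require Import all_classical all_reals all_analysis.

Set Implicit Arguments.
Unset Strict Implicit.
Unset Printing Implicit Defensive.

Import Order.TTheory GRing.Theory Num.Theory.
Import numFieldNormedType.Exports.

Local Open Scope classical_set_scope.
Local Open Scope ring_scope.

(* Distribution function of W_n, the weight of a uniformly chosen vertex. *)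
Definition empirical_cdf (R : realType) (n : nat) (w : 'I_n -> R) (x : R) : R :=
  n%:R^-1 * \sum_(i < n) (w i <= x)%R%:R.

(* Convergence in distribution to W of real random variables given by their
   distribution functions F n: pointwise at every continuity point of the
   distribution function of W. *)
Definition cvg_in_distribution (R : realType) (F : nat -> R -> R)
    d (T : measurableType d) (P : probability T R) (W : {RV P >-> R}) : Prop :=
  forall x : R, {for x, continuous (cdf W)} ->
    (F n x)%:E @[n --> \oo] --> cdf W x.

Section Potts.
Context (R : realType) d (T : measurableType d) (P : probability T R).
Variables (W : {RV P >-> R}) (q : nat).
Implicit Types (beta B s : R) (y Bv : 'rV[R]_q).

(* E[W] as a real number; meaningful because E[W] is finite under the standing
   assumptions. *)
Definition meanW : R := fine 'E_P[W].

Definition beta' beta : R := expR beta - 1.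

(* Expectations of functions of W, and suprema, are kept in the extended reals,
   so that no value is arbitrary for lack of integrability or boundedness. *)
Definition F_potts beta Bv y : \bar R :=
  'E_P[fun t => (ln (\sum_(k < q)
          expR (beta' beta / meanW * y 0 k * W t + Bv 0 k)))%R].

(* The spins 1, ..., q are the elements 0, ..., q - 1 of 'I_q: the field acts on
   the index 0. *)
Definition field B : 'rV[R]_q :=
  \row_(k < q) (if k == 0%N :> nat then B else 0).

Definition objective beta B y : \bar R :=
  (F_potts beta (field B) y
     - (beta' beta / (2 * meanW) * \sum_(k < q) y 0 k ^+ 2)%:E)%E.

Definition phi beta B : \bar R := ereal_sup (range (objective beta B)).

Definition optimizer beta B y : Prop := objective beta B y = phi beta B.

Definition y_of s : 'rV[R]_q :=
  \row_(k < q) (meanW / q%:R *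
    (if k == 0%N :> nat then 1 + (q%:R - 1) * s else 1 - s)).

Definition p_of beta B s : \bar R :=
  ('E_P[fun t => (ln (expR (beta' beta * W t * s + B) + q%:R - 1))%R]
     - (beta' beta * meanW / (2 * q%:R)
          * ((q%:R - 1) * s ^+ 2 + 2 * s - 1))%:E)%E.

Definition sup_p beta B : \bar R :=
  ereal_sup [set p_of beta B s | s in `[0, 1]].

End Potts.

(* Main.v *)
Require Import Defs.
From HB Require Import structures.
From mathcomp Require Import all_boot all_order all_algebra.
From mathcomp Require Import all_fingroup.
From mathcomp Require Import all_classical all_reals all_analysis.
From mathcomp Require Import measurable_realfun ring lra.

(* The pressure functional is the mean of a convex log-partition function minus a
   quadratic.  Convexity makes the map sending y to the weighted Gibbs means
   E[W p_k] increase the pressure, so a maximizer is a fixed point of it: its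
   coordinates are positive and sum to E[W].  A strictly convex function meets a
   line at most twice, so the coordinates take at most two values; if two of them
   share the larger value, moving one up and the other down by the gap between
   the values increases the pressure strictly.  Swapping coordinates shows that
   a positive field puts the larger value on the first spin.  What remains is
   the family y(s), along which the pressure is p(s); every maximizer of p is
   then a global maximizer, and its stationarity condition is the difference of
   two coordinates of the fixed-point equation. *)

Import Order.TTheory GRing.Theory Num.Theory.
Import numFieldNormedType.Exports.

Local Open Scope classical_set_scope.
Local Open Scope ring_scope.

(** * Partition functions and Gibbs weights *)

Section Partition.
Context {R : realType}.
Implicit Types (x y l : R).

(** Averages the strict tangent-line inequality at [z] over [x] and [y], both of which differ from
    [z]; the linear terms cancel. *)
Lemma expR_convex_lt l x y : 0 < l < 1 -> x != y ->
  expR (l * x + (1 - l) * y) < l * expR x + (1 - l) * expR y.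
Proof.
move=> /andP[l0 l1] xy; pose z := l * x + (1 - l) * y.
have tangent u : u != z -> expR z * (1 + (u - z)) < expR u.
  move=> uz; rewrite -[in ltRHS](subrKC z u) (expRD z) ltr_pM2l ?expR_gt0//.
  by rewrite expR_gt1Dx// subr_eq0.
have xz : x != z.
  apply: contra_neq xy => xz; apply: (mulfI (_ : 1 - l != 0)); first lra.
  by move: xz; rewrite /z; lra.
have yz : y != z.
  apply: contra_neq xy => yz; apply: (mulfI (_ : l != 0)); first lra.
  by move: yz; rewrite /z; lra.
have hx := tangent _ xz; have hy := tangent _ yz.
rewrite (_ : expR _ =
  l * (expR z * (1 + (x - z))) + (1 - l) * (expR z * (1 + (y - z)))).
  by apply: ltrD; rewrite ltr_pM2l ?subr_gt0.
by rewrite -/z [in RHS]/z; ring.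
Qed.

Context {q : nat}.
Implicit Types a : 'I_q -> R.

Definition pf a := \sum_(k < q) expR (a k).

Definition gibbs a k := expR (a k) / pf a.

Hypothesis q_gt0 : (0 < q)%N.

Lemma pf_gt0 a : 0 < pf a.
Proof.
rewrite /pf (bigD1 (Ordinal q_gt0))//= ltr_pwDl ?expR_gt0//.
by rewrite sumr_ge0// => k _; exact: expR_ge0.
Qed.

Lemma gibbs_gt0 a k : 0 < gibbs a k.
Proof. by rewrite divr_gt0 ?expR_gt0 ?pf_gt0. Qed.

Lemma sum_gibbs a : \sum_k gibbs a k = 1.
Proof. by rewrite -mulr_suml divff// gt_eqF ?pf_gt0. Qed.

Lemma gibbs_le1 a k : gibbs a k <= 1.
Proof.
rewrite -(sum_gibbs a) [leRHS](bigD1 k)//= lerDl sumr_ge0// => j _.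
exact/ltW/gibbs_gt0.
Qed.

(* Jensen's inequality for the exponential under the weights [gibbs a]. *)
Lemma ln_pf_subgradient a a' :
  \sum_k gibbs a k * (a' k - a k) <= ln (pf a') - ln (pf a).
Proof.
set m := (X in X <= _).
rewrite -ln_div ?posrE ?pf_gt0// -ler_expR lnK ?posrE ?divr_gt0 ?pf_gt0//.
have -> : pf a' / pf a = \sum_k gibbs a k * expR (a' k - a k).
  rewrite /pf mulr_suml; apply: eq_bigr => k _.
  by rewrite /gibbs mulrAC -expRD subrKC.
(* The deviations [a' k - a k - m] have mean zero under [gibbs a], so the tangent line of the
   exponential at [m] can be compared term by term. *)
have -> : expR m = \sum_k gibbs a k * (expR m * (1 + (a' k - a k - m))).
  rewrite (eq_bigr (fun k => expR m * (gibbs a k * (a' k - a k))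
      + expR m * (1 - m) * gibbs a k)); last by move=> k _; ring.
  rewrite big_split/= -!mulr_sumr sum_gibbs -/m; ring.
apply: ler_sum => k _; rewrite ler_pM2l ?gibbs_gt0//.
by rewrite -[in leRHS](subrKC m (_ - _)) (expRD m) ler_pM2l ?expR_gt0 ?expR_ge1Dx.
Qed.

(** Uses the subgradient based at [a'], whose components are Gibbs weights and so lie between 0 and
    1. *)
Lemma ln_pf_lipschitz a a' : ln (pf a') - ln (pf a) <= \sum_k `|a' k - a k|.
Proof.
rewrite -lerN2 opprB (le_trans _ (ln_pf_subgradient a' a))// -sumrN.
apply: ler_sum => k _; rewrite lerNl -mulrN opprB (le_trans (ler_norm _))//.
by rewrite normrM ler_piMl// gtr0_norm ?gibbs_gt0 ?gibbs_le1.
Qed.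

End Partition.

(** * Means of real functions *)

Section RealIntegral.
Context {R : realType} {d : measure_display} {T : measurableType d}.
Variable P : probability T R.
Implicit Types f g W : T -> R.

Local Notation integrable f := (P.-integrable [set: T] (EFin \o f)).

Lemma expectation_Rintegral f : integrable f ->
  ('E_P[f] = (\int[P]_t f t)%:E)%E.
Proof. by move=> intf; rewrite unlock fineK// integrable_fin_num. Qed.

Lemma Rintegrable_sum (I : finType) (f : I -> T -> R) :
  (forall i, integrable (f i)) -> integrable (fun t => \sum_i f i t).
Proof.
move=> intf; apply: (eq_integrable _ (fun t => \sum_i (f i t)%:E)%E) => //.
  by move=> t _; rewrite sumEFin.
by apply: integrable_sum => // i _; exact: intf.
Qed.

Lemma Rintegrable_scale (c : R) f : integrable f ->
  integrable (fun t => c * f t).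
Proof.
move=> intf; apply: (eq_integrable _ (fun t => c%:E * (f t)%:E)%E) => //.
exact: integrableZl intf.
Qed.

Lemma RintegrableB f g : integrable f -> integrable g ->
  integrable (fun t => f t - g t).
Proof.
move=> intf intg.
apply: (eq_integrable _ ((EFin \o f) \- (EFin \o g))%E) => //.
exact: integrableB.
Qed.

Lemma Rintegral_sum (I : finType) (f : I -> T -> R) :
  (forall i, integrable (f i)) ->
  \int[P]_t (\sum_i f i t) = \sum_i \int[P]_t f i t.
Proof.
move=> intf; apply: EFin_inj; rewrite -sumEFin.
transitivity (\sum_i \int[P]_t (f i t)%:E)%E; last first.
  by apply: eq_bigr => i _; rewrite fineK// integrable_fin_num//; exact: intf.
rewrite -integral_sum// fineK.
  by apply: eq_integral => t _; rewrite sumEFin.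
by apply: integrable_fin_num => //; exact: Rintegrable_sum.
Qed.

Lemma dominated_integrable W f C : integrable W -> measurable_fun setT f ->
  (forall t, `|f t| <= C * (1 + `|W t|)) -> integrable f.
Proof.
move=> intW mf fC.
apply: (@le_integrable _ _ _ P setT measurableT (EFin \o f)
   (fun t => C%:E * (1 + `|W t|%:E))%E).
- exact/measurable_EFinP.
- move=> t _ /=; rewrite lee_fin (le_trans (fC t))//.
  by rewrite ler_norm.
- apply: integrableZl => //; apply: integrableD => //.
    exact: finite_measure_integrable_cst.
  exact: integrable_abse intW.
Qed.

(** If the mean of [f] vanished, [f] would be zero almost everywhere, and hence [W] too,
    contradicting its positive mean. Strict inequalities between exponents degenerate at [W = 0],
    hence the two separate sign conditions on [f]. *)
Lemma Rintegral_gt0 W f : integrable W -> integrable f ->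
  {ae P, forall t, 0 <= W t} -> 0 < \int[P]_t W t ->
  (forall t, 0 <= W t -> 0 <= f t) -> (forall t, 0 < W t -> 0 < f t) ->
  0 < \int[P]_t f t.
Proof.
move=> intW intf W0 EW f_ge0 f_gt0.
have f0 : {ae P, forall t, 0 <= f t} by apply: filterS W0.
have nf : \int[P]_t `|f t| = \int[P]_t f t.
  congr fine; apply: ae_eq_integral => //.
  - apply/measurable_EFinP/measurableT_comp => //.
    by case/integrableP: intf => /measurable_EFinP.
  - by case/integrableP: intf.
  - by apply: filterS f0 => t ft _ /=; rewrite ger0_norm.
rewrite lt0r -nf Rintegral_ge0// andbT; apply/eqP => If0.
have /(ae_eq_integral_abs _ measurableT) : (\int[P]_t `|(EFin \o f) t| = 0)%E.
  rewrite -[RHS]/((0 : R)%:E) -If0 fineK//.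
  by apply: integrable_fin_num => //; exact: integrable_norm.
case/integrableP: (intf) => mf _ /(_ mf) f_ae0.
suff : \int[P]_t W t = 0 by apply/eqP; rewrite gt_eqF.
rewrite /Rintegral (@ae_eq_integral _ _ _ P _ (cst 0%E)) ?integral0//.
- by case/integrableP: intW.
- apply: filterS2 f_ae0 W0 => t /(_ I)[ft0] Wt _ /=; congr EFin; apply/eqP.
  rewrite eq_le Wt andbT leNgt; apply/negP => /f_gt0.
  by rewrite ft0 ltxx.
Qed.

Lemma Rintegral_lt W f g : integrable W -> integrable f -> integrable g ->
  {ae P, forall t, 0 <= W t} -> 0 < \int[P]_t W t ->
  (forall t, 0 <= W t -> f t <= g t) -> (forall t, 0 < W t -> f t < g t) ->
  \int[P]_t f t < \int[P]_t g t.
Proof.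
move=> intW intf intg W0 EW fg_le fg_lt; rewrite -subr_gt0 -RintegralB//.
apply: (@Rintegral_gt0 W) => //.
- exact: RintegrableB.
- by move=> t /fg_le; rewrite subr_ge0.
- by move=> t /fg_lt; rewrite subr_gt0.
Qed.

End RealIntegral.

(** * Maximizers of the pressure *)

Lemma cvg_sumR {R : realType} (I : finType) (T : Type) (F : set_system T)
    {FF : Filter F} (f : I -> T -> R) (l : I -> R) :
  (forall i, f i x @[x --> F] --> l i) ->
  \sum_i f i x @[x --> F] --> \sum_i l i.
Proof.
move=> fl; apply: (@cvg_big R I +%R 0 xpredT) => //.
exact: (@pseudometric_normed_Zmodule.add_continuous _ R).
Qed.

Section Pressure.
Context {R : realType} {d : measure_display} {T : measurableType d}.
Context {P : probability T R}.
Variable W : {RV P >-> R}.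
Context {q : nat}.
Variables (a : R) (Bv : 'rV[R]_q).
Implicit Types (y z : 'rV[R]_q) (i j k l : 'I_q).

Definition expo y t k := a * y 0 k * W t + Bv 0 k.

(** With [a = beta' / meanW] and [Bv] the external field, this is the real value of the bracket
    under the supremum. *)
Definition pressure y :=
  \int[P]_t ln (pf (expo y t)) - a / 2 * \sum_k y 0 k ^+ 2.

(** [a] times this vector is a subgradient at [y] of the integral in [pressure]. *)
Definition gibbs_mean y : 'rV[R]_q :=
  \row_k \int[P]_t (W t * gibbs (expo y t) k).

Hypotheses (q_gt0 : (0 < q)%N) (a_gt0 : 0 < a).
Hypothesis intW : P.-integrable [set: T] (EFin \o W).
Hypothesis W_ge0 : {ae P, forall t, 0 <= W t}.
Hypothesis EW_gt0 : 0 < \int[P]_t W t.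

(** * Measurability, integrability and the subgradient inequality *)

Lemma measurable_expo y k : measurable_fun setT (fun t => expo y t k).
Proof. by apply: measurable_funD => //; apply: measurable_funM. Qed.

Lemma measurable_pf y : measurable_fun setT (fun t => pf (expo y t)).
Proof.
apply: measurable_sum => k.
by apply: measurableT_comp => //; exact: measurable_expo.
Qed.

Lemma measurable_ln_pf y : measurable_fun setT (fun t => ln (pf (expo y t))).
Proof. exact: (measurableT_comp (@measurable_ln R) (measurable_pf y)). Qed.

Lemma measurable_gibbs y k : measurable_fun setT (fun t => gibbs (expo y t) k).
Proof.
have -> : (fun t => gibbs (expo y t) k) =
    (fun t => expR (expo y t k - ln (pf (expo y t)))).
  by apply/funext => t; rewrite expRD expRN lnK ?posrE ?pf_gt0.
apply: measurableT_comp => //; apply: measurable_funB.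
  exact: measurable_expo.
exact: measurable_ln_pf.
Qed.

Lemma integrable_ln_pf y :
  P.-integrable [set: T] (EFin \o (fun t => ln (pf (expo y t)))).
Proof.
(* Comparison with the zero exponent, by the Lipschitz bound in both directions, gives growth at
   most linear in [W]. *)
pose L : R := ln (pf (fun _ : 'I_q => 0)).
apply: (@dominated_integrable _ _ _ _ W _
    (`|L| + \sum_k (`|a * y 0 k| + `|Bv 0 k|)) intW (measurable_ln_pf y)) => t.
have W0 := normr_ge0 (W t).
have S : \sum_k `|expo y t k - 0| <=
    (\sum_k (`|a * y 0 k| + `|Bv 0 k|)) * (1 + `|W t|).
  rewrite mulr_suml; apply: ler_sum => k _; rewrite subr0.
  rewrite (le_trans (ler_normD _ _))// normrM.
  have := normr_ge0 (Bv 0 k); have := normr_ge0 (a * y 0 k).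
  nra.
have := ln_pf_lipschitz q_gt0 (fun=> 0) (expo y t).
have := ln_pf_lipschitz q_gt0 (expo y t) (fun=> 0); rewrite -/L.
under eq_bigr do rewrite distrC.
move=> h1 h2; rewrite mulrDl ler_norml.
have := ler_norm L; have := ler_norm (- L); rewrite normrN => h3 h4.
have := normr_ge0 L.
by move=> h5; apply/andP; split; nra.
Qed.

Lemma integrable_gibbs y k :
  P.-integrable [set: T] (EFin \o (fun t => W t * gibbs (expo y t) k)).
Proof.
apply: (@dominated_integrable _ _ _ _ W _ 1 intW).
  by apply: measurable_funM => //; exact: measurable_gibbs.
move=> t; rewrite mul1r normrM ler_wpDl// ler_piMr//.
by rewrite gtr0_norm ?gibbs_gt0// gibbs_le1.
Qed.

Lemma gibbs_mean_gt0 y k : 0 < gibbs_mean y 0 k.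
Proof.
rewrite mxE; have pos := Rintegral_gt0 P W _ intW (integrable_gibbs y k).
apply: pos => // t Wt.
  by rewrite mulr_ge0// ltW ?gibbs_gt0.
by rewrite mulr_gt0 ?gibbs_gt0.
Qed.

Lemma sum_gibbs_mean y : \sum_k gibbs_mean y 0 k = \int[P]_t W t.
Proof.
under eq_bigr do rewrite mxE.
rewrite -Rintegral_sum; last exact: integrable_gibbs.
by apply: eq_Rintegral => t _; rewrite -mulr_sumr sum_gibbs// mulr1.
Qed.

(** The fields cancel in the difference of exponents, leaving [a * (z 0 k - y 0 k) * W t]; the
    pointwise inequality is then integrated. *)
Lemma Rintegral_ln_pf_subgradient y z :
  a * \sum_k (z 0 k - y 0 k) * gibbs_mean y 0 k <=
  \int[P]_t ln (pf (expo z t)) - \int[P]_t ln (pf (expo y t)).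
Proof.
have intZ c k : P.-integrable [set: T]
    (EFin \o (fun t => c * (W t * gibbs (expo y t) k))).
  by apply: Rintegrable_scale; exact: integrable_gibbs.
rewrite -RintegralB ?integrable_ln_pf//.
rewrite mulr_sumr.
under eq_bigr => k _ do rewrite mxE mulrA -RintegralZl ?integrable_gibbs//.
rewrite -Rintegral_sum; last by move=> k; exact: intZ.
apply: le_Rintegral => //.
- by apply: Rintegrable_sum => k; exact: intZ.
- by apply: RintegrableB; exact: integrable_ln_pf.
move=> t _; rewrite (le_trans _ (ln_pf_subgradient q_gt0 (expo y t) (expo z t)))//.
by apply: ler_sum => k _; rewrite /expo le_eqVlt; apply/orP; left; apply/eqP; ring.
Qed.

(* [gibbs_mean] is the ascent map whose fixed points are the stationary points:
   convexity of the log-partition function makes it increase the pressure. *)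
Lemma pressure_gibbs_mean y : pressure y +
    a / 2 * \sum_k (gibbs_mean y 0 k - y 0 k) ^+ 2 <= pressure (gibbs_mean y).
Proof.
have := Rintegral_ln_pf_subgradient y (gibbs_mean y).
rewrite /pressure; set z := gibbs_mean y; set Fz := Rintegral _ _ _ => h.
(* Polarization: [2 * (z - y) * z = z ^+ 2 - y ^+ 2 + (z - y) ^+ 2] in each coordinate; the last
   square is the gain. *)
suff : a * \sum_k (z 0 k - y 0 k) * z 0 k = a / 2 * \sum_k z 0 k ^+ 2
    - a / 2 * \sum_k y 0 k ^+ 2 + a / 2 * \sum_k (z 0 k - y 0 k) ^+ 2 by lra.
rewrite -!mulrBr -!mulrDr.
rewrite -sumrB -big_split/= !mulr_sumr; apply: eq_bigr => k _; by field.
Qed.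

(** * Stationarity and shape of maximizers *)

Definition maximizer y := forall z, pressure z <= pressure y.

(** The ascent map gains at least [a / 2] times the squared displacement, and a maximizer leaves no
    room for a gain. No derivative is taken. *)
Lemma maximizer_stationary y : maximizer y -> gibbs_mean y = y.
Proof.
move=> /(_ (gibbs_mean y)) ymax; have := pressure_gibbs_mean y.
set S := \sum_k _ => h.
have S0 : S = 0.
  apply/eqP; rewrite eq_le sumr_ge0 ?andbT => [|k _]; last exact: sqr_ge0.
  by rewrite -(@pmulr_rle0 _ (a / 2)) ?divr_gt0//; lra.
apply/rowP => k; apply/eqP; rewrite -subr_eq0 -sqrf_eq0; apply/eqP.
by move/psumr_eq0P : S0; apply => // j _; exact: sqr_ge0.
Qed.

Lemma maximizer_gt0 y k : maximizer y -> 0 < y 0 k.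
Proof. by move=> /maximizer_stationary <-; exact: gibbs_mean_gt0. Qed.

Lemma sum_change2 {F G : 'I_q -> R} i k : i != k ->
  (forall j, j != i -> j != k -> G j = F j) ->
  \sum_j G j = \sum_j F j + (G i - F i) + (G k - F k).
Proof.
move=> ik GF; rewrite (bigD1 i)//= (bigD1 k) 1?eq_sym//=.
rewrite [in RHS](bigD1 i)//= [in RHS](bigD1 k) 1?eq_sym//=.
rewrite (eq_bigr F); first by ring.
by move=> j /andP[]; exact: GF.
Qed.

Lemma pressure_lt y z :
  (forall t, 0 <= W t -> pf (expo y t) <= pf (expo z t)) ->
  (forall t, 0 < W t -> pf (expo y t) < pf (expo z t)) ->
  \sum_k z 0 k ^+ 2 = \sum_k y 0 k ^+ 2 -> pressure y < pressure z.
Proof.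
move=> le lt eqS; rewrite /pressure eqS ltrD2r.
have Ilt := Rintegral_lt P W _ _ intW (integrable_ln_pf y) (integrable_ln_pf z).
apply: Ilt => // t Wt.
  by rewrite ler_ln ?posrE ?pf_gt0// le.
by rewrite ltr_ln ?posrE ?pf_gt0// lt.
Qed.

Lemma gibbs_mean_lt y k i :
  (forall t, expo y t k < expo y t i) -> gibbs_mean y 0 k < gibbs_mean y 0 i.
Proof.
move=> lt; rewrite !mxE.
have Ilt := Rintegral_lt P W _ _ intW (integrable_gibbs y k) (integrable_gibbs y i).
have glt t : gibbs (expo y t) k < gibbs (expo y t) i.
  by rewrite ltr_pM2r ?invr_gt0 ?pf_gt0// ltr_expR.
apply: Ilt => // t Wt; first by rewrite ler_wpM2l// ltW.
by rewrite ltr_pM2l.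
Qed.

(** Equal coordinates contradict stationarity, since the larger field gives the larger Gibbs weight.
    Coordinates in reverse order could be swapped: this keeps the sum of squares and, where [W] is
    positive, raises the partition function by a product of two positive differences. *)
Lemma maximizer_field_lt y i k : maximizer y -> Bv 0 k < Bv 0 i ->
  y 0 k < y 0 i.
Proof.
move=> ymax Bki; have ik : i != k by apply: contraTneq Bki => ->; rewrite ltxx.
case: ltgtP => // [yik|yik]; last first.
  suff : gibbs_mean y 0 k < gibbs_mean y 0 i.
    by rewrite (maximizer_stationary _ ymax) yik ltxx.
  by apply: gibbs_mean_lt => t; rewrite /expo yik ltrD2l.
pose z : 'rV[R]_q := \row_j y 0 (tperm i k j).
have zi : z 0 i = y 0 k by rewrite mxE tpermL.
have zk : z 0 k = y 0 i by rewrite mxE tpermR.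
have zE j : j != i -> j != k -> z 0 j = y 0 j.
  by move=> ji jk; rewrite mxE tpermD// eq_sym.
have pfE t : pf (expo z t) = pf (expo y t) +
    (expR (a * y 0 k * W t) - expR (a * y 0 i * W t)) *
    (expR (Bv 0 i) - expR (Bv 0 k)).
  rewrite /pf (sum_change2 (F := fun j => expR (expo y t j)) i k)//; last first.
    by move=> j ji jk; rewrite /expo zE.
  by rewrite /expo zi zk !expRD; ring.
have := ymax z; rewrite leNgt => /negP; case; apply: pressure_lt.
- move=> t Wt; rewrite pfE lerDl mulr_ge0// subr_ge0 ler_expR; last exact: ltW.
  by rewrite -!mulrA ler_wpM2l ?(ltW a_gt0)// ler_wpM2r// ltW.
- move=> t Wt; rewrite pfE ltrDl mulr_gt0// subr_gt0 ltr_expR//.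
  by rewrite -!mulrA ltr_pM2l// ltr_pM2r.
- rewrite (sum_change2 (F := fun j => y 0 j ^+ 2) i k)//.
    by rewrite zi zk; ring.
  by move=> j ji jk; rewrite zE.
Qed.

(* Two coordinates in zero field and one in a nonnegative field would be three
   points of a line met by a strictly convex function. *)
Lemma maximizer_no_three_values y i j k : maximizer y ->
  Bv 0 i = 0 -> Bv 0 j = 0 -> 0 <= Bv 0 k ->
  y 0 i < y 0 j -> y 0 j < y 0 k -> False.
Proof.
move=> ymax Bi Bj Bk yij yjk.
have yk0 : 0 < y 0 k by exact: maximizer_gt0.
(* The weight that makes [y 0 j] a convex combination of [y 0 i] and [y 0 k]. *)
pose l := (y 0 k - y 0 j) / (y 0 k - y 0 i).
have l01 : 0 < l < 1.
  rewrite divr_gt0 ?subr_gt0//; last exact: lt_trans yjk.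
  by rewrite ltr_pdivrMr ?subr_gt0 ?mul1r ?ltrD2l ?ltrN2//; exact: lt_trans yjk.
have lE : l * y 0 i + (1 - l) * y 0 k = y 0 j.
  by rewrite /l; field; rewrite subr_eq0 gt_eqF// (lt_trans yij).
have [l0 l1] : 0 < l /\ 0 < 1 - l by case/andP: l01 => -> ?; rewrite subr_gt0.
(* The exponential cancels the field in the weight of [k]; since that field is nonnegative,
   [c <= 1 - l]. *)
pose c := (1 - l) * expR (- Bv 0 k).
have lt t : 0 < W t -> gibbs (expo y t) j <
    l * gibbs (expo y t) i + c * gibbs (expo y t) k.
  move=> Wt; rewrite !mulrA -mulrDl ltr_pM2r ?invr_gt0 ?pf_gt0//.
  rewrite /c -mulrA -expRD /expo Bi Bj !addr0 addrCA addNr addr0 -lE.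
  rewrite (_ : a * _ * W t = l * (a * y 0 i * W t) + (1 - l) * (a * y 0 k * W t)).
    apply: expR_convex_lt => //; rewrite lt_eqF//.
    by rewrite -!mulrA ltr_pM2l// ltr_pM2r// (lt_trans yij).
  by ring.
have Ilt : \int[P]_t (W t * gibbs (expo y t) j) <
    \int[P]_t (l * (W t * gibbs (expo y t) i) + c * (W t * gibbs (expo y t) k)).
  have Ilt := Rintegral_lt P W _ _ intW (integrable_gibbs y j).
  apply: Ilt => // [|t|t Wt].
  - apply: (eq_integrable _ (fun t => (l * (W t * gibbs (expo y t) i))%:E +
      (c * (W t * gibbs (expo y t) k))%:E)%E) => //.
    by apply: integrableD => //;
      apply: Rintegrable_scale; exact: integrable_gibbs.
  - rewrite le_eqVlt => /predU1P[<-|Wt]; first by rewrite !mul0r !mulr0 addr0.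
    by rewrite (mulrCA l) (mulrCA c) -mulrDr ler_wpM2l ?ltW// lt.
  - by rewrite (mulrCA l) (mulrCA c) -mulrDr ltr_pM2l// lt.
rewrite RintegralD ?RintegralZl// in Ilt; last 4 first.
- exact: integrable_gibbs.
- exact: integrable_gibbs.
- by apply: Rintegrable_scale; exact: integrable_gibbs.
- by apply: Rintegrable_scale; exact: integrable_gibbs.
have gE m : \int[P]_t (W t * gibbs (expo y t) m) = y 0 m.
  by rewrite -[in RHS](maximizer_stationary _ ymax) mxE.
(* Stationarity has turned the integrals into [y 0 j < l * y 0 i + c * y 0 k], which [c <= 1 - l]
   and [0 < y 0 k] forbid. *)
move: Ilt; rewrite !gE -[ltLHS]lE ltrD2l ltr_pM2r// ltNge => /negP; apply.
by rewrite /c ger_pMr// -expR0 ler_expR oppr_le0.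
Qed.

(* If the two larger coordinates are equal, raising one and lowering the other
   by their gap [h] to [y 0 k] multiplies the partition function by
   [1 + l * (expR x - 1)] where [x = a * h * W] and [l] is the difference of
   Gibbs weights; by strict convexity of the exponential its logarithm exceeds
   [l * x], whose mean [a * h ^+ 2] is the cost in the quadratic term. *)
Lemma maximizer_no_double_top y i j k : maximizer y ->
  Bv 0 i = 0 -> Bv 0 j = 0 -> Bv 0 k = 0 -> i != j ->
  y 0 i = y 0 j -> y 0 k < y 0 i -> False.
Proof.
move=> ymax Bi Bj Bk ij yij yki; pose h := y 0 i - y 0 k.
have h0 : 0 < h by rewrite subr_gt0.
have ki : k != i by apply: contraTneq yki => ->; rewrite ltxx.
pose z : 'rV[R]_q :=
  \row_m (y 0 m + (if m == i then h else if m == j then - h else 0)).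
have zi : z 0 i = y 0 i + h by rewrite mxE eqxx.
have zj : z 0 j = y 0 k by rewrite mxE eq_sym (negPf ij) eqxx -yij /h; ring.
have zE m : m != i -> m != j -> z 0 m = y 0 m.
  by move=> mi mj; rewrite mxE (negPf mi) (negPf mj) addr0.
have sumz : \sum_m z 0 m ^+ 2 = \sum_m y 0 m ^+ 2 + 2 * h ^+ 2.
  rewrite (sum_change2 (F := fun m => y 0 m ^+ 2) i j)//.
    by rewrite zi zj -yij /h; ring.
  by move=> m mi mj; rewrite zE.
pose l t := gibbs (expo y t) i - gibbs (expo y t) k.
pose x t := a * h * W t.
have pfE t : pf (expo z t) = pf (expo y t) * (1 + l t * (expR (x t) - 1)).
  rewrite {1}/pf (sum_change2 (F := fun m => expR (expo y t m)) i j)//; last first.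
    by move=> m mi mj; rewrite /expo zE.
  rewrite -/(pf _) /l /gibbs -mulrBl mulrDr mulr1 mulrA [pf _ * (_ / _)]mulrC.
  rewrite divfK ?gt_eqF ?pf_gt0// /expo zi zj Bi Bj Bk !addr0 -yij -addrA.
  congr (_ + _); rewrite mulrBr mulr1 mulrBl -!expRD.
  rewrite (_ : a * y 0 i * W t + x t = a * (y 0 i + h) * W t);
    last by rewrite /x; ring.
  rewrite (_ : a * y 0 k * W t + x t = a * y 0 i * W t);
    last by rewrite /x /h; ring.
  by ring.
have gt t : 0 < W t -> x t * l t < ln (pf (expo z t)) - ln (pf (expo y t)).
  move=> Wt; have x0 : 0 < x t by rewrite !mulr_gt0.
  have l0 : 0 < l t.
    rewrite subr_gt0 ltr_pM2r ?invr_gt0 ?pf_gt0// ltr_expR /expo Bi Bk !addr0.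
    by rewrite -!mulrA ltr_pM2l// ltr_pM2r.
  have l1 : l t < 1.
    by rewrite ltrBlDr (le_lt_trans (gibbs_le1 q_gt0 _ _))// ltrDl gibbs_gt0.
  have e0 : 0 < 1 + l t * (expR (x t) - 1).
    by rewrite ltr_pwDl// mulr_ge0// ?ltW// subr_gt0 expR_gt1.
  rewrite pfE lnM ?posrE ?pf_gt0// addrC addKr -ltr_expR lnK ?posrE//.
  (* Strict convexity between the points [x t] and 0, with weight [l t] on the first. *)
  have := @expR_convex_lt _ (l t) (x t) 0; rewrite l0 l1 gt_eqF// => /(_ isT isT).
  by rewrite mulr0 addr0 expR0 mulr1 mulrC; lra.
have intz := integrable_ln_pf z; have inty := integrable_ln_pf y.
have Igi := integrable_gibbs y i; have Igk := integrable_gibbs y k.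
have intx : P.-integrable [set: T] (EFin \o (fun t => a * h *
    (W t * gibbs (expo y t) i - W t * gibbs (expo y t) k))).
  by apply: Rintegrable_scale; apply: RintegrableB.
have Ilt := Rintegral_lt P W _ _ intW intx (RintegrableB _ _ _ intz inty).
have {}Ilt : a * h * h <
    \int[P]_t ln (pf (expo z t)) - \int[P]_t ln (pf (expo y t)).
  have gE m : \int[P]_t (W t * gibbs (expo y t) m) = y 0 m.
    by rewrite -[in RHS](maximizer_stationary _ ymax) mxE.
  (* By stationarity one factor [h] is itself the mean of [W] times the difference of Gibbs weights,
     so both sides become integrals. *)
  rewrite -RintegralB// {2}/h -!gE -RintegralB// -RintegralZl//; last first.
    exact: RintegrableB.
  have xl t : a * h * (W t * gibbs (expo y t) i - W t * gibbs (expo y t) k) =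
      x t * l t by rewrite /x /l; ring.
  apply: Ilt => // t; last by move=> /gt; rewrite xl.
  rewrite le_eqVlt => /predU1P[W0|/gt]; last by rewrite xl; exact: ltW.
  rewrite xl pfE /x -W0 !mulr0 expR0 subrr mulr0 addr0 mulr1 subrr mul0r.
  exact: lexx.
move: (ymax z) Ilt; rewrite /pressure sumz.
move: (\int[P]_t ln (pf (expo z t))) (\int[P]_t ln (pf (expo y t))) => Fz Fy.
by move: (\sum_m y 0 m ^+ 2) => S; lra.
Qed.

(** Of two different coordinates off [i], the larger either ties with [y 0 i], which forces zero
    field and a double top, or lies strictly below it, which gives three values. *)
Lemma maximizer_minority_equal y i : maximizer y ->
  (forall k, k != i -> Bv 0 k = 0) -> 0 <= Bv 0 i ->
  (forall k, y 0 k <= y 0 i) -> (0 < Bv 0 i -> forall k, k != i -> y 0 k < y 0 i) ->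
  forall k l, k != i -> l != i -> y 0 k = y 0 l.
Proof.
move=> ymax Bk Bi yi ylt k l.
wlog : k l / y 0 k < y 0 l => [wl ki li|ykl ki li].
  have [kl|kl|//] := ltgtP (y 0 k) (y 0 l); first exact: wl.
  by apply/esym/wl.
exfalso; have := yi l; rewrite le_eqVlt => /predU1P[yli|yli].
  have Bi0 : Bv 0 i = 0.
    apply/eqP; rewrite eq_le Bi andbT leNgt; apply/negP => /ylt/(_ l li).
    by rewrite yli ltxx.
  apply: (maximizer_no_double_top y l i k) => //; exact: Bk.
by apply: (maximizer_no_three_values y k l i) => //; exact: Bk.
Qed.

(** * Continuity of the pressure and existence of a maximizer *)

Lemma Rintegral_ln_pf_lipschitz y z :
  \int[P]_t ln (pf (expo z t)) - \int[P]_t ln (pf (expo y t)) <=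
  a * (\int[P]_t W t) * \sum_k `|z 0 k - y 0 k|.
Proof.
(* Based at [z], the subgradient bounds the increment from above; each Gibbs mean lies between 0 and
   the mean of [W]. *)
have := Rintegral_ln_pf_subgradient z y.
rewrite -lerN2 opprB => /le_trans; apply.
rewrite -mulrN -mulrA ler_pM2l// -sumrN mulr_sumr; apply: ler_sum => k _.
have g0 := gibbs_mean_gt0 z k.
have gW : gibbs_mean z 0 k <= \int[P]_t W t.
  rewrite -(sum_gibbs_mean z) [leRHS](bigD1 k)//= lerDl sumr_ge0// => j _.
  exact/ltW/gibbs_mean_gt0.
rewrite -mulNr opprB mulrC (@le_trans _ _ (gibbs_mean z 0 k * `|z 0 k - y 0 k|))//.
  by rewrite ler_pM2l// ler_norm.
by rewrite ler_wpM2r.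
Qed.

Lemma cvg_pressure y : (pressure z : R) @[z --> y] --> pressure y.
Proof.
pose C : R := a * \int[P]_t W t.
have cvgF : (\int[P]_t ln (pf (expo z t)) : R) @[z --> y] -->
    \int[P]_t ln (pf (expo y t)).
  have dist_cvg : (C * \sum_k `|z 0 k - y 0 k| : R) @[z --> y]
      --> C * \sum_k `|y 0 k - y 0 k|.
    apply: cvgMl_tmp. apply: cvg_sumR => k; apply: cvg_norm.
    by apply: cvgB; [exact: coord_continuous|exact: cvg_cst].
  apply/(@cvgrPdist_le _ _ _ (nbhs y)) => e e0.
  move/(@cvgrPdist_le _ _ _ (nbhs y)): dist_cvg => /(_ e e0); apply: filterS => z.
  rewrite [X in C * X - _]big1 ?mulr0 ?sub0r ?normrN => [|k _]; last first.
    by rewrite subrr normr0.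
  move=> /(le_trans (ler_norm _)) dist_le.
  rewrite (le_trans _ dist_le)// ler_norml; apply/andP; split.
    rewrite lerNl opprB; exact: Rintegral_ln_pf_lipschitz.
  rewrite (le_trans (Rintegral_ln_pf_lipschitz z y))//.
  by under eq_bigr do rewrite distrC.
have cvgS : (a / 2 * \sum_k z 0 k ^+ 2 : R) @[z --> y] -->
    a / 2 * \sum_k y 0 k ^+ 2.
  apply: cvgMl_tmp; apply: cvg_sumR => k.
  rewrite expr2; under eq_fun do rewrite expr2.
  by apply: cvgM; exact: coord_continuous.
exact: cvgB cvgF cvgS.
Qed.

(** On a compact box the maximum is attained by continuity; outside it the quadratic cost beats the
    linear growth of the integral, so the pressure is at most its value at 0. *)
Lemma maximizer_exists : exists y, maximizer y.
Proof.
(* The radius is such that a single coordinate with [r < |z_k|] has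
   [(|z_k| - m) ^+ 2 >= (m * q) ^+ 2], which offsets the total [q * m ^+ 2] left by completing
   squares in all coordinates. *)
pose m := \int[P]_t W t; pose r : R := m * q.+1%:R.
have r0 : 0 <= r by rewrite mulr_ge0// ltW.
pose K := [set v : 'rV[R]_q | forall k, (`[- r, r]%classic : set R) (v ord0 k)].
have K0 : K 0 by move=> k; rewrite mxE /= in_itv/= oppr_le0 r0.
have cK : compact K.
  have cI k : compact ((fun=> `[- r, r]%classic) k : set R).
    exact: segment_compact.
  exact: (rV_compact cI).
have cf : {within K, continuous pressure}.
  by apply: continuous_subspaceT => z; exact: cvg_pressure.
have [y _ ymax] := EVT_max_rV (ex_intro _ 0 K0) cK cf.
exists y => z; have [zK|zK] := pselect (K z); first by apply: ymax; rewrite inE.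
apply: (le_trans _ (ymax 0 _)); last by rewrite inE.
have [k zk] : exists k, r < `|z 0 k|.
  apply: contrapT => nzk; apply: zK => k; rewrite /= in_itv/= -ler_norml leNgt.
  by apply/negP => zk; apply: nzk; exists k.
have := Rintegral_ln_pf_lipschitz 0 z; rewrite -/m /pressure.
have -> : \sum_j (0 : 'rV[R]_q) 0 j ^+ 2 = 0.
  by rewrite big1// => j _; rewrite mxE expr0n.
under eq_bigr do rewrite mxE subr0.
have : \sum_j (2 * m * `|z 0 j| - z 0 j ^+ 2) <= 0.
  rewrite (eq_bigr (fun j => m ^+ 2 - (`|z 0 j| - m) ^+ 2)); last first.
    by move=> j _; rewrite sqrrB real_normK ?num_real//; ring.
  rewrite sumrB sumr_const card_ord subr_le0 (bigD1 k)//= ler_wpDr//.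
    by rewrite sumr_ge0// => j _; exact: sqr_ge0.
  have zkm : m * q%:R <= `|z 0 k| - m.
    by rewrite lerBrDr (le_trans _ (ltW zk))// /r -[q.+1]addn1 natrD mulrDr mulr1.
  have mq0 : 0 <= m * q%:R by rewrite mulr_ge0// ltW.
  apply: (@le_trans _ _ ((m * q%:R) ^+ 2)); last first.
    by rewrite ler_sqr ?nnegrE// (le_trans mq0).
  rewrite exprMn -[m ^+ 2 *+ q]mulr_natr ler_pM2l ?exprn_gt0// expr2.
  rewrite ler_peMr// ler1n.
  exact: q_gt0.
rewrite sumrB -mulr_sumr; set A := \sum_j _; set S := \sum_j _ => h1 h2.
have : a / 2 * (2 * m * A - S) <= 0 by rewrite pmulr_rle0 ?divr_gt0.
move: h2; rewrite (mulr0 (a / 2)).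
move: (\int[P]_t ln (pf (expo z t))) (\int[P]_t ln (pf (expo 0 t))) => Fz F0.
by lra.
Qed.

End Pressure.

(** * The limiting weight *)

Section LimitWeight.
Context {R : realType} {d : measure_display} {T : measurableType d}.
Context {P : probability T R}.
Variable W : {RV P >-> R}.

(** A monotone function has only countably many discontinuities, a null set, while an open interval
    has positive Lebesgue measure. *)
Lemma cdf_continuity_point {a b : R} : a < b ->
  exists2 x : R, a < x < b & {for x, continuous (cdf W)}.
Proof.
move=> ab; pose F r := fine (cdf W r).
have cdfE : cdf W = EFin \o F.
  by apply/funext => r /=; rewrite fineK// fin_num_measure.
have ndF x y : x <= y -> F x <= F y.
  move=> xy; rewrite /F fine_le ?fin_num_measure//; exact: cdf_nondecreasing.
have [x xab xF] : exists2 x, x \in `]a, b[ & ~ discontinuity F x.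
  apply: contrapT => nex.
  have ndF' : {in `[a, b] &, nondecreasing_fun F} by move=> x y _ _; exact: ndF.
  have := countable_lebesgue_measure0 (discontinuity_countable ndF').
  rewrite (_ : [set _ | _] = `]a, b[%classic).
    rewrite lebesgue_measure_itv/= lte_fin ab -EFinB => -[] /eqP.
    by rewrite subr_eq0 gt_eqF.
  apply/seteqP; split=> x /= => [[]//|xab]; split=> //.
  by apply: contrapT => xF; apply: nex; exists x.
exists x; first by move: xab; rewrite in_itv.
(* The right limit is the value, the left limit exists by monotonicity, and the absence of a jump
   makes the two agree. *)
have Fright : F y @[y --> x^'+] --> F x.
  have := @cdf_right_continuous _ _ _ _ W x.
  by rewrite cdfE => /fine_cvgP[].
have Fleft : cvg (F y @[y --> x^'-]).
  apply: nondecreasing_at_left_is_cvgr; first by near=> s => y z _ _; exact: ndF.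
  near=> s; exists (F x) => _ /= [y /andP[_ yx] <-]; exact/ndF/ltW.
have Flim : lim (F y @[y --> x^'-]) = F x.
  apply: contrapT => ne; apply: xF; split=> //; first exact: cvgP Fright.
  by rewrite (cvg_lim _ Fright)//; apply/eqP.
rewrite /prop_for /continuous_at cdfE; apply: cvg_EFin; first exact: nearW.
apply/left_right_continuousP; split; last exact: Fright.
rewrite [X in _ --> X](_ : _ = lim (F y @[y --> x^'-])); first exact: Fleft.
exact: esym Flim.
Unshelve. all: by end_near. Qed.

Context {F : nat -> R -> R}.
Hypothesis F_cvg : cvg_in_distribution F W.

(** A continuity point between [x] and 0 shows that the limiting distribution function vanishes at
    every negative [x]; countably many such [x] exhaust the event that [W] is negative. *)
Lemma cvg_in_distribution_ge0 :
  (forall n x, x < 0 -> F n x = 0) -> {ae P, forall t, 0 <= W t}.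
Proof.
move=> F0.
have cdf0 x : x < 0 -> cdf W x = 0%E.
  move=> x0; have [y /andP[xy y0] /F_cvg Fy] := cdf_continuity_point x0.
  apply/eqP; rewrite eq_le cdf_ge0 andbT.
  have /le_trans := cdf_nondecreasing W (ltW xy); apply.
  by apply: (cvge_le _ Fy); apply: nearW => n; rewrite F0.
pose N k := W @^-1` `]-oo, - k.+1%:R^-1].
have N0 k : P.-negligible (N k).
  apply/negligibleP; first exact: measurable_funPTI.
  by apply: cdf0; rewrite oppr_lt0.
apply: negligibleS (negligible_bigcup N0) => t /= /negP; rewrite -ltNge => Wt.
have /ltr_add_invr[k] : 0 < - W t by rewrite oppr_gt0.
rewrite add0r => kW; exists k => //; rewrite /N/= in_itv/=.
by rewrite lerNr ltW.
Qed.

(* Compares [W] with [2 + \sum_k 2 ^+ k.+2 * \1_(2 ^+ k.+1 <= W)]: a continuity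
   point of the distribution function between consecutive powers of two carries
   the tail bound to the limit, and [2 < tau] makes the means a geometric
   series. *)
Lemma cvg_in_distribution_integrable (c tau : R) : 0 < c -> 2 < tau ->
  (forall n x, x < 0 -> F n x = 0) ->
  (forall n x, (0 < n)%N -> 1 <= x -> 1 - F n x <= c * x `^ (- (tau - 1))) ->
  P.-integrable [set: T] (EFin \o W).
Proof.
move=> c0 tau2 F0 tail; have Wge0 := cvg_in_distribution_ge0 F0.
have mW : measurable_fun setT (EFin \o W) by exact/measurable_EFinP.
(* The factor by which the tail bound shrinks when the threshold doubles. *)
pose r : R := 2 `^ (- (tau - 1)).
pose A k := W @^-1` `[(2 ^+ k.+1 : R), +oo[.
have mA k : measurable (A k) by exact: measurable_funPTI.
have PA k : (P (A k) <= (c * r ^+ k)%:E)%E.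
  have k2 : (2 : R) ^+ k < 2 ^+ k.+1 by rewrite ltr_eXn2l ?ltr1n.
  have [x /andP[kx xk] /F_cvg Fx] := cdf_continuity_point k2.
  have x1 : 1 <= x by rewrite (le_trans _ (ltW kx))// exprn_ege1// ler1n.
  have : (ccdf W x <= (c * r ^+ k)%:E)%E.
    rewrite ccdf_1_cdf leeBlDr ?fin_num_measure// -leeBlDl// -EFinB.
    apply: (cvge_ge _ Fx); near=> n.
    have n0 : (0 < n)%N by near: n; exact: nbhs_infty_gt.
    rewrite lee_fin lerBlDl -lerBlDr (le_trans (tail n x n0 x1))//.
    rewrite ler_pM2l// /r -powR_mulrn ?powR_ge0// powRAC powR_mulrn//.
    rewrite !powRN lef_pV2 ?posrE ?powR_gt0 ?exprn_gt0//; last exact: lt_le_trans x1.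
    by rewrite ge0_ler_powR ?nnegrE ?ltW// ?exprn_gt0//; lra.
  apply: le_trans; apply: le_measure.
  - by rewrite inE; exact: mA.
  - by rewrite inE; exact: measurable_funPTI.
  by move=> t; rewrite /A /= !in_itv/= !andbT; exact: lt_le_trans.
pose f k t : \bar R := ((2 ^+ k.+2)%:E * (\1_(A k) t)%:E)%E.
have f0 k t : (0 <= f k t)%E by rewrite mule_ge0// lee_fin ?exprn_ge0// indicE.
have mf k : measurable_fun setT (f k).
  by apply: measurable_funeM; apply/measurable_EFinP; exact: measurable_indic.
have If k : (\int[P]_t f k t <= (4 * c * (2 * r) ^+ k)%:E)%E.
  rewrite ge0_integralZl_EFin ?exprn_ge0//; last first.
    by apply/measurable_EFinP; exact: measurable_indic.
  rewrite integral_indic// setIT.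
  apply: (@le_trans _ _ ((2 ^+ k.+2)%:E * (c * r ^+ k)%:E)%E).
    by rewrite lee_wpmul2l ?lee_fin ?exprn_ge0//; exact: PA.
  by rewrite -EFinM lee_fin exprMn !exprS; lra.
(* [2 * r] is 2 to the power [- (tau - 2)]. *)
have r2 : 0 < 2 * r < 1.
  rewrite mulr_gt0 ?powR_gt0//= -[X in X * r](@powRr1 R 2)//.
  rewrite -powRD ?pnatr_eq0 ?implybT//.
  rewrite (_ : 1 + _ = - (tau - 2)); last lra.
  rewrite powRN invf_lt1 ?powR_gt0//.
  have tau0 : 0 < tau - 2 by lra.
  have := gt0_ltr_powR tau0 (x := 1) (y := 2); rewrite powR1; apply.
  - by rewrite nnegrE.
  - by rewrite nnegrE.
  - by rewrite ltr1n.
have Sf : (\sum_(k <oo) \int[P]_t f k t < +oo)%E.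
  apply: (@le_lt_trans _ _ (4 * c / (1 - 2 * r))%:E); last exact: ltry.
  apply: lime_le; first by apply: is_cvg_nneseries => k _ _; exact: integral_ge0.
  apply: nearW => n; apply: (le_trans (lee_sum _ (fun k _ => If k))).
  rewrite sumEFin lee_fin; case/andP: r2 => r0 r1.
  by apply: geometric_le_lim => //; rewrite ?mulr_ge0 ?ltW ?ger0_norm ?ltW.
have mSf : measurable_fun setT (fun t => \sum_(k <oo) f k t)%E.
  exact: ge0_emeasurable_sum.
apply/integrableP; split=> //.
apply: (@le_lt_trans _ _ (\int[P]_t (2%:E + \sum_(k <oo) f k t))%E); last first.
  rewrite ge0_integralD// ?integral_cst//=; last first.
    by move=> t _; exact: nneseries_ge0.
  by rewrite probability_setT mule1 integral_nneseries// lte_add_pinfty// ltry.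
apply: ae_ge0_le_integral => //.
- exact: measurableT_comp.
- by move=> t _; rewrite adde_ge0 ?nneseries_ge0.
- by apply: emeasurable_funD.
apply: filterS Wge0 => t Wt _ /=; rewrite ger0_norm//.
have [W2|W2] := leP (W t) 2.
  by rewrite -[leLHS]adde0 leeD ?lee_fin ?nneseries_ge0.
(* With [k + 1] the integer binary logarithm of the integer part of [W t], the single term of index
   [k] equals [2 ^+ k.+2] and already dominates [W t]. *)
pose m := Num.truncn (W t).
have /andP[mW1 mW2] := truncn_itv Wt; rewrite -/m in mW1 mW2.
have m2 : (2 <= m)%N by rewrite /m truncn_ge_nat// ltW.
have /andP[km mk] := trunc_log_bounds (isT : 1 < 2)%N (leq_trans (isT : 0 < 2)%N m2).
have k0 : (0 < trunc_log 2 m)%N.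
  by rewrite lt0n; apply/eqP => k0; move: mk; rewrite k0 expn1 ltnNge m2.
move: km mk; rewrite -(prednK k0); set k := _.-1 => km mk.
have Ak : t \in A k.
  rewrite inE /A/= in_itv/= andbT (le_trans _ mW1)// -natrX ler_nat.
  exact: km.
have fk : f k t = (2 ^+ k.+2)%:E by rewrite /f indicE Ak mule1.
rewrite -[leLHS]add0e leeD ?lee_fin//.
apply: (le_trans _ (nneseries_lim_ge k.+1 _)); last by move=> *; exact: f0.
rewrite big_nat_recr//= -[leLHS]add0e leeD ?sume_ge0//.
rewrite fk lee_fin (le_trans (ltW mW2))// -natrX ler_nat.
exact: mk.
Unshelve. all: by end_near. Qed.

End LimitWeight.

Lemma empirical_cdf_lt0 (R : realType) (n : nat) (w : 'I_n -> R) (x : R) :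
  (forall i, 0 < w i) -> x < 0 -> empirical_cdf w x = 0.
Proof.
move=> w0 x0; rewrite /empirical_cdf big1 ?mulr0// => i _.
by rewrite leNgt (lt_trans x0).
Qed.

(** * The one-parameter variational problem *)

Section Optimizers.
Context {R : realType} {d : measure_display} {T : measurableType d}.
Context {P : probability T R}.
Variable W : {RV P >-> R}.
Context {q : nat}.
Variables (beta B : R).
Implicit Types (y z : 'rV[R]_q) (i k : 'I_q) (s : R).

Hypothesis q_gt0 : (0 < q)%N.
Hypotheses (beta_gt0 : 0 < beta) (B_ge0 : 0 <= B).
Hypothesis intW : P.-integrable [set: T] (EFin \o W).
Hypothesis W_ge0 : {ae P, forall t, 0 <= W t}.
Hypothesis EW_gt0 : (0 < 'E_P[W])%E.

Let m := meanW W.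
Let b := beta' beta.
Let p := pressure W (b / m) (field q B).
Let i0 := Ordinal q_gt0.

Lemma meanWE : \int[P]_t W t = m.
Proof. by rewrite /m /meanW expectation_Rintegral. Qed.

Lemma meanW_gt0 : 0 < \int[P]_t W t.
Proof. by rewrite -lte_fin -expectation_Rintegral. Qed.

Let m_gt0 : 0 < m. Proof. by rewrite -meanWE meanW_gt0. Qed.

Lemma beta'_meanW_gt0 : 0 < b / m.
Proof. by rewrite divr_gt0// subr_gt0 expR_gt1. Qed.

Let a_gt0 := beta'_meanW_gt0.

Lemma natr_predn : q.-1%:R = q%:R - 1 :> R.
Proof. by rewrite -subn1 natrB. Qed.

Lemma field0 k : k != i0 -> field q B 0 k = 0.
Proof. by rewrite mxE -val_eqE /= => /negPf ->. Qed.

Lemma field_i0 : field q B 0 i0 = B.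
Proof. by rewrite mxE. Qed.

Lemma objectiveE y : objective W beta B y = (p y)%:E.
Proof.
rewrite /objective /F_potts expectation_Rintegral; last first.
  exact: (integrable_ln_pf W (b / m) (field q B) q_gt0 intW y).
rewrite -EFinB; congr EFin; rewrite /p /pressure; congr (_ - _ * _).
by rewrite invfM mulrA mulrAC.
Qed.

Lemma phi_maximizer y : maximizer W (b / m) (field q B) y ->
  phi W q beta B = (p y)%:E.
Proof.
move=> ymax; apply/eqP; rewrite eq_le; apply/andP; split.
  by apply: ge_ereal_sup => _ [z _ <-]; rewrite objectiveE lee_fin; exact: ymax.
by apply: ereal_sup_ubound; exists y => //; exact: objectiveE.
Qed.

Lemma optimizerP y :
  optimizer W beta B y <-> maximizer W (b / m) (field q B) y.
Proof.
split=> [opt z|ymax]; last by rewrite /optimizer objectiveE -phi_maximizer.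
rewrite -lee_fin -!objectiveE opt.
by apply: ereal_sup_ubound; exists z.
Qed.

(** The vector y(s) with the distinguished spin moved to [i], as in zero field any spin may
    dominate. *)
Definition spike i s : 'rV[R]_q := \row_k (m / q%:R *
  (if k == i then 1 + (q%:R - 1) * s else 1 - s)).

Lemma spike_i0 s : spike i0 s = y_of W q s.
Proof. by apply/rowP => k; rewrite !mxE -val_eqE. Qed.

Lemma spike_perm i s : spike i s = col_perm (tperm i i0) (y_of W q s).
Proof.
apply/rowP => k; rewrite -spike_i0 !mxE; congr (_ * _).
by rewrite -{2}(tpermL i i0) (inj_eq perm_inj).
Qed.

(** The coordinates are positive and sum to the mean of [W], so the common value off [i] determines
    the vector. Its positivity gives [s <= 1], and the maximality of [y 0 i] gives [0 <= s]. *)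
Lemma spike_of_minority_equal y i : maximizer W (b / m) (field q B) y ->
  (forall k, y 0 k <= y 0 i) ->
  (forall k l, k != i -> l != i -> y 0 k = y 0 l) ->
  exists2 s, s \in `[0, 1] & y = spike i s.
Proof.
move=> ymax yi yeq.
have y0 k : 0 < y 0 k.
  exact: (maximizer_gt0 W (b / m) (field q B) q_gt0 a_gt0 intW W_ge0
    meanW_gt0 y k ymax).
have sumy : \sum_k y 0 k = m.
  rewrite -meanWE -(sum_gibbs_mean W (b / m) (field q B) q_gt0 intW y).
  by rewrite (maximizer_stationary _ _ _ q_gt0 a_gt0 intW).
have [[k ki]|nk] := pselect (exists k, k != i); last first.
  (* With a single spin the coefficient [q - 1] of [s] vanishes, so the choice of [s] is
     immaterial. *)
  exists 0; first by rewrite in_itv/= lexx ler01.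
  have all_i k : k = i by apply: contrapT => /eqP ki; apply: nk; exists k.
  have q1 : q%:R = 1 :> R.
    rewrite -(card_ord q) -cardsT (_ : finset.setT = [set i]%SET) ?cards1//.
    by apply/finset.setP => k; rewrite !inE (all_i k) eqxx.
  apply/rowP => k; rewrite mxE (all_i k) eqxx mulr0 addr0 mulr1 -sumy.
  rewrite (bigD1 i)//= big1 ?addr0 => [|l]; last by rewrite (all_i l) eqxx.
  by rewrite q1 divr1.
have sumyE : m = y 0 i + (q%:R - 1) * y 0 k.
  rewrite -sumy (bigD1 i)//= (eq_bigr (fun=> y 0 k)); last first.
    by move=> l li; exact: yeq.
  by rewrite sumr_const cardC1 card_ord -[X in _ + X = _]mulr_natl natr_predn.
have q0 : q%:R != 0 :> R by rewrite pnatr_eq0 -lt0n.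
(* Solves [m / q * (1 - s) = y 0 k] for [s]. *)
exists (1 - q%:R * y 0 k / m).
  rewrite in_itv/= subr_ge0 gerBl ler_pdivrMr// mul1r.
  apply/andP; split; last by rewrite divr_ge0 ?mulr_ge0 ?(ltW (y0 _)) ?(ltW m_gt0).
  by have := yi k; lra.
apply/rowP => l; rewrite mxE; case: eqVneq => [->|li].
  rewrite (_ : y 0 i = m - (q%:R - 1) * y 0 k); last by rewrite sumyE addrK.
  by field; rewrite q0 gt_eqF.
by rewrite (yeq l k)//; field; rewrite q0 gt_eqF.
Qed.

(** The dominant spin is the first one under a positive field, by [maximizer_field_lt], and any
    largest coordinate in zero field. *)
Lemma maximizer_spike y : maximizer W (b / m) (field q B) y ->
  exists2 i, 0 < B -> i = i0 & exists2 s, s \in `[0, 1] & y = spike i s.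
Proof.
move=> ymax; pose top i := forall k, y 0 k <= y 0 i.
have [i [topi i_i0 ilt]] : exists i, [/\ top i, 0 < B -> i = i0 &
    0 < B -> forall k, k != i -> y 0 k < y 0 i].
  have [B0|B0] := ltP 0 B.
    have lt k : k != i0 -> y 0 k < y 0 i0.
      move=> ki; apply: (maximizer_field_lt W (b / m) (field q B) q_gt0 a_gt0
        intW W_ge0 meanW_gt0 y _ _ ymax).
      by rewrite field0// field_i0.
    exists i0; split=> // k.
    by have [->//|/lt/ltW] := eqVneq k i0.
  have [i _ imax] := @arg_maxP _ _ _ i0 xpredT (fun k => y 0 k) isT.
  exists i; split=> [k|//|//]; exact: imax.
exists i => //; apply: spike_of_minority_equal => //.
have fieldi k : k != i -> field q B 0 k = 0.
  have [->|ki0 _] := eqVneq k i0; last exact: field0.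
  rewrite field_i0 => ii0; apply/eqP; rewrite eq_le B_ge0 andbT leNgt.
  by apply/negP => /i_i0 ii0'; rewrite ii0' eqxx in ii0.
apply: (maximizer_minority_equal W (b / m) (field q B) q_gt0 a_gt0 intW W_ge0
  meanW_gt0 y i ymax fieldi) => //.
- have [->|ii0] := eqVneq i i0; first by rewrite field_i0.
  by rewrite field0.
- have [ii0|ii0] := eqVneq i i0; last by rewrite field0// ltxx.
  by rewrite ii0 field_i0 -ii0.
Qed.

(** * The pressure along the family y(s) *)

Lemma expo_y_of s t k : expo W (b / m) (field q B) (y_of W q s) t k =
  b * (1 - s) / q%:R * W t + (if k == i0 then b * W t * s + B else 0).
Proof.
have q0 : q%:R != 0 :> R by rewrite pnatr_eq0 -lt0n.
rewrite /expo -spike_i0 mxE; case: eqVneq => [->|ki].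
  by rewrite field_i0; field; rewrite q0 gt_eqF.
by rewrite field0//; field; rewrite q0 gt_eqF.
Qed.

(** All spins share a background exponent, which factors out; the first spin keeps its excess and
    the other [q - 1] contribute 1 each. *)
Lemma pf_y_of s t : pf (expo W (b / m) (field q B) (y_of W q s) t) =
  expR (b * (1 - s) / q%:R * W t) * (expR (b * W t * s + B) + q%:R - 1).
Proof.
rewrite /pf; under eq_bigr do rewrite expo_y_of expRD.
rewrite -mulr_sumr; congr (_ * _); rewrite (bigD1 i0)//= -addrA.
congr (_ + _); rewrite (eq_bigr (fun=> 1)) => [|k /negPf ->]; last first.
  by rewrite expR0.
by rewrite sumr_const cardC1 card_ord natr_predn.
Qed.

Lemma expRDq_gt0 (x : R) : 0 < expR x + q%:R - 1.
Proof. by rewrite -addrA ltr_pwDl ?expR_gt0// subr_ge0 ler1n. Qed.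

(** The logarithm of the common factor is linear in [W]; its mean combines with the quadratic term
    into the polynomial of [p_of]. *)
Lemma p_ofE s : p_of W q beta B s = (p (y_of W q s))%:E.
Proof.
have q0 : q%:R != 0 :> R by rewrite pnatr_eq0 -lt0n.
pose c := b * (1 - s) / q%:R.
pose L t := ln (pf (expo W (b / m) (field q B) (y_of W q s) t)).
have LE t : ln (expR (b * W t * s + B) + q%:R - 1) = L t - c * W t.
  rewrite /L pf_y_of lnM ?posrE ?expR_gt0 ?expRDq_gt0// expRK.
  by rewrite /c; ring.
have intL := integrable_ln_pf W (b / m) (field q B) q_gt0 intW (y_of W q s).
have intcW := Rintegrable_scale P c _ intW.
rewrite /p_of -/b; under eq_fun do rewrite LE.
rewrite expectation_Rintegral; last exact: RintegrableB.
rewrite RintegralB// RintegralZl// meanWE -EFinB; congr EFin.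
rewrite /p /pressure -/(L _) -addrA; congr (_ + _).
have -> : \sum_k y_of W q s 0 k ^+ 2 =
    (m / q%:R) ^+ 2 * ((1 + (q%:R - 1) * s) ^+ 2 + (q%:R - 1) * (1 - s) ^+ 2).
  rewrite -spike_i0 (bigD1 i0)//= mxE ?eqxx exprMn mulrDr; congr (_ + _).
  rewrite (eq_bigr (fun=> (m / q%:R) ^+ 2 * (1 - s) ^+ 2)); last first.
    by move=> k /negPf ki; rewrite mxE ki exprMn.
  by rewrite sumr_const cardC1 card_ord -[_ *+ _]mulr_natl natr_predn; ring.
by rewrite /c -/m; field; rewrite q0 gt_eqF.
Qed.

Lemma sup_p_le_phi : (sup_p W q beta B <= phi W q beta B)%E.
Proof.
apply: ge_ereal_sup => _ [s _ <-]; rewrite p_ofE -objectiveE.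
by apply: ereal_sup_ubound; exists (y_of W q s).
Qed.

Lemma p_of_le_sup s : s \in `[0, 1] -> (p_of W q beta B s <= sup_p W q beta B)%E.
Proof. by move=> s01; apply: ereal_sup_ubound; exists s. Qed.

(** In zero field the pressure is invariant under permutations of the spins; in a positive field [i]
    is already the first spin. *)
Lemma pressure_spike i s : (0 < B -> i = i0) ->
  p (spike i s) = p (y_of W q s).
Proof.
have [B0 /(_ isT) ->|B0 _] := ltP 0 B; first by rewrite spike_i0.
have {}B0 : B = 0 by apply/eqP; rewrite eq_le B0.
pose v := y_of W q s.
have sumE (h : R -> R -> R) : \sum_k h (spike i s 0 k) (field q B 0 k) =
    \sum_k h (v 0 k) (field q B 0 k).
  rewrite [RHS](reindex_inj (@perm_inj _ (tperm i i0))).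
  by apply: eq_bigr => k _; rewrite spike_perm !mxE B0 !if_same.
have pfE t : pf (expo W (b / m) (field q B) (spike i s) t) =
    pf (expo W (b / m) (field q B) v t).
  exact: (sumE (fun x h => expR (b / m * x * W t + h))).
rewrite /p /pressure (sumE (fun x _ => x ^+ 2)).
by under eq_Rintegral do rewrite pfE.
Qed.

(** A maximizer exists and is a [spike], so its pressure is a value of [p_of] on the unit
    interval. *)
Lemma phi_sup_p : phi W q beta B = sup_p W q beta B.
Proof.
apply/eqP; rewrite eq_le sup_p_le_phi andbT.
have [y ymax] := maximizer_exists W (b / m) (field q B) q_gt0 a_gt0 intW
  W_ge0 meanW_gt0.
have [i ii0 [s s01 yE]] := maximizer_spike _ ymax.
by rewrite (phi_maximizer _ ymax) yE pressure_spike// -p_ofE p_of_le_sup.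
Qed.

(** As both suprema agree, y(s) is a global maximizer and hence a fixed point of [gibbs_mean], also
    when [s] is an endpoint. A second spin is needed to compare with the first; for one spin [p_of]
    does not depend on [s]. *)
Lemma sup_p_stationary s : (1 < q)%N -> p_of W q beta B s = sup_p W q beta B ->
  ('E_P[fun t => (W t / m * ((expR (b * W t * s + B) - 1)
     / (expR (b * W t * s + B) + q%:R - 1)))%R] = s%:E)%E.
Proof.
move=> q1 sE; pose y := y_of W q s; pose i1 := Ordinal q1.
have ymax : maximizer W (b / m) (field q B) y.
  by apply/optimizerP; rewrite /optimizer objectiveE -p_ofE sE phi_sup_p.
have q0 : q%:R != 0 :> R by rewrite pnatr_eq0 -lt0n.
pose g k t := W t * gibbs (expo W (b / m) (field q B) y t) k.
have intg k := integrable_gibbs W (b / m) (field q B) q_gt0 intW y k.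
have gE k : \int[P]_t g k t = y 0 k.
  by rewrite -[in RHS](maximizer_stationary _ _ _ q_gt0 a_gt0 intW _ ymax) mxE.
(* The fraction is the difference of the Gibbs weights of the first two spins; the matching
   coordinates of y(s) differ by [m * s]. *)
have fE t : W t / m * ((expR (b * W t * s + B) - 1)
     / (expR (b * W t * s + B) + q%:R - 1)) = m^-1 * (g i0 t - g i1 t).
  rewrite /g /gibbs pf_y_of !expo_y_of !expRD /= expR0.
  have := expRDq_gt0 (b * W t * s + B); rewrite expRD => pos.
  field; rewrite !gt_eqF ?expR_gt0//.
under eq_fun do rewrite fE.
have intd := RintegrableB P _ _ (intg i0) (intg i1).
rewrite expectation_Rintegral; last exact: Rintegrable_scale.
rewrite RintegralZl// RintegralB ?intg// !gE /y -spike_i0 !mxE /=.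
by congr EFin; rewrite -/m; field; rewrite q0 gt_eqF.
Qed.

End Optimizers.

Theorem theorem1p5 (R : realType)
    (w : forall n : nat, 'I_n -> R)
    (w_gt0 : forall (n : nat) (i : 'I_n), 0 < w n i)
    (d : measure_display) (T : measurableType d) (P : probability T R)
    (W : {RV P >-> R})
    (W_lim : cvg_in_distribution (fun n => empirical_cdf (w n)) W)
    (EW_gt0 : (0 < 'E_P[W])%E)
    (c tau : R) (c_gt0 : 0 < c) (tau_gt2 : 2 < tau)
    (tail : forall (n : nat) (x : R), (0 < n)%N -> 1 <= x ->
       1 - empirical_cdf (w n) x <= c * x `^ (- (tau - 1)))
    (q : nat) (q_gt0 : (0 < q)%N)
    (beta : R) (beta_gt0 : 0 < beta)
    (B : R) (B_ge0 : 0 <= B) :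
  [/\ exists y : 'rV[R]_q, optimizer W beta B y,
      B = 0 -> forall y : 'rV[R]_q, optimizer W beta B y ->
        exists s : R, s \in `[0, 1] /\
          exists sigma : 'S_q, y = col_perm sigma (y_of W q s),
      0 < B -> forall y : 'rV[R]_q, optimizer W beta B y ->
        exists s : R, s \in `[0, 1] /\ y = y_of W q s,
      phi W q beta B = sup_p W q beta B
    & (1 < q)%N -> forall s : R, s \in `[0, 1] ->
        p_of W q beta B s = sup_p W q beta B ->
        ('E_P[fun t => (W t / meanW W *
               ((expR (beta' beta * W t * s + B) - 1)
                / (expR (beta' beta * W t * s + B) + q%:R - 1)))%R]
          = s%:E)%E].

Proof.
(* The weight sequence enters only through two properties of the limit: [W] is nonnegative almost
   everywhere and integrable. *)
have F0 n x : x < 0 -> empirical_cdf (w n) x = 0.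
  exact: empirical_cdf_lt0.
have W_ge0 := cvg_in_distribution_ge0 _ W_lim F0.
have intW := cvg_in_distribution_integrable _ W_lim c tau c_gt0 tau_gt2 F0 tail.
have optP y := optimizerP W beta B q_gt0 intW y.
have spikeE y := maximizer_spike W beta B q_gt0 beta_gt0 B_ge0 intW W_ge0 EW_gt0 y.
split.
- have [y ymax] := maximizer_exists W (beta' beta / meanW W) (field q B) q_gt0
    (beta'_meanW_gt0 W beta beta_gt0 intW EW_gt0) intW W_ge0
    (meanW_gt0 W intW EW_gt0).
  by exists y; apply/optP.
- move=> _ y /optP/spikeE[i _ [s s01 ->]]; exists s; split; first exact: s01.
  exists (tperm i (Ordinal q_gt0)).
  exact: spike_perm.
- move=> B0 y /optP/spikeE[i /(_ B0)-> [s s01 ->]]; exists s.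
  by split; [exact: s01|exact: spike_i0].
- exact: (phi_sup_p W beta B q_gt0 beta_gt0 B_ge0 intW W_ge0 EW_gt0).
- move=> q1 s _; exact: sup_p_stationary.
Qed.
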